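(* Let $1\le\ell\le m$ be integers, let $k=\binom{m}{\ell}$ and $\mu:=\max\{\ell,m-\ell\}+1$. Given $\Lambda\subseteq I_\ell[m]$, we have $$K_\Lambda\le(\ell-1)\binom{|\Lambda|}{2}.$$ Moreover, equality holds if and only if $\Lambda$ is a close family. Consequently, for any nonnegative integer $r\le k$, we have $$K_r(\ell,m)\le(\ell-1)\binom{r}{2}.$$ Moreover, equality holds in this last inequality if and only if $r\le\mu$.
   Context: $[m]:=\{1,\dots,m\}$, and $I_\ell[m]$ denotes the set of all subsets of $[m]$ of cardinality $\ell$. A family $\Lambda\subseteq I_\ell[m]$ is called close if $|A\cap B|=\ell-1$ for all distinct $A,B\in\Lambda$. For $\Lambda=\{A_1,\dots,A_r\}\subseteq I_\ell[m]$ with $|\Lambda|=r$ (the $A_i$ distinct), put $K_\Lambda:=\sum_{1\le i<j\le r}|A_i\cap A_j|$. For an integer $0\le r\le k$, put $K_r(\ell,m):=\max\{K_\Lambda : \Lambda\subseteq I_\ell[m],\ |\Lambda|=r\}$. *)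

(* Defs.v *)
From mathcomp Require Import all_boot.
Set Implicit Arguments.
Unset Strict Implicit.
Unset Printing Implicit Defensive.

(* The ground set [m] = {1, ..., m} is encoded as 'I_m = {0, ..., m - 1}. *)
Definition lsubsets (l m : nat) : {set {set 'I_m}} :=
  [set A : {set 'I_m} | #|A| == l].

(* Closeness is only meant for L \subset lsubsets l m with 0 < l, so the truncated
   subtraction l - 1 is the integer one. *)
Definition close (l m : nat) (L : {set {set 'I_m}}) : Prop :=
  forall A B, A \in L -> B \in L -> A != B -> #|A :&: B| = l - 1.

(* enum_val lists L as A_0, ..., A_(r-1) without repetition, r = #|L|; the sum
   does not depend on the order, as |A :&: B| is symmetric in A and B. *)
Definition K_family (m : nat) (L : {set {set 'I_m}}) : nat :=
  \sum_(i < #|L|) \sum_(j < #|L| | i < j)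
    #|(enum_val i : {set 'I_m}) :&: enum_val j|.

(* For r <= 'C(m, l) the range is nonempty, so this is a genuine maximum (the
   value 0 of an empty \max only occurs for r > 'C(m, l)). *)
Definition K_max (r l m : nat) : nat :=
  \max_(L : {set {set 'I_m}} | (L \subset lsubsets l m) && (#|L| == r)) K_family L.

(* Main.v *)
(**
  Two distinct [l]-sets meet in at most [l - 1] points, which gives the bound on
  [K_family] termwise.  If [A != B] lie in a close family [L], then either
  every member contains [A :&: B], or some member [D] misses a point [i] of
  [A :&: B]; in the latter case [D = (A :|: B) :\ i] and every member is
  contained in [A :|: B].  So [L] has at most [m - l + 1] or [l + 1] members, and
  the families of all [l]-sets above an [(l - 1)]-set, or below an
  [(l + 1)]-set, are close and attain these sizes.
*)
Require Import Defs.
From mathcomp Require Import all_boot.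

Set Implicit Arguments.
Unset Strict Implicit.
Unset Printing Implicit Defensive.

(** Exchanging the sums leaves [j] choices of [i] below each [j], and the numbers below [n] add up
    to ['C(n, 2)]. *)
Lemma sum_pairs_const (n c : nat) :
  \sum_(i < n) \sum_(j < n | i < j) c = c * 'C(n, 2).
Proof.
rewrite (exchange_big_dep xpredT) //= -bin2_sum big_distrr big_mkord /=.
apply: eq_bigr => j _; rewrite sum_nat_const mulnC; congr (_ * _).
by rewrite -sum1_card (big_ord_narrow (ltnW (ltn_ord j))) sum1_card card_ord.
Qed.

Lemma exists_subset_card (T : finType) (U : {set T}) (r : nat) :
  r <= #|U| -> exists2 A : {set T}, A \subset U & #|A| = r.
Proof.
rewrite -bin_gt0 -cards_draws => /card_gt0P[A].
by rewrite inE => /andP[AU /eqP Ar]; exists A.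
Qed.

Lemma card_setI_distinct (T : finType) (l : nat) (A B : {set T}) :
  #|A| = l -> #|B| = l -> A != B -> #|A :&: B| <= l - 1.
Proof.
move=> Al Bl neAB.
have lt : #|A :&: B| < l.
  rewrite -[X in _ < X]Al proper_card // properEneq subsetIl andbT.
  apply: contra neAB => /eqP/setIidPl AB.
  by rewrite eqEcard AB Al Bl leqnn.
(* [lt] also forces [0 < l], so the truncated [l - 1] is a true predecessor. *)
by rewrite leq_subRL ?add1n // (leq_ltn_trans _ lt).
Qed.

(** Using [leqif] carries the equality case along with the bound: a sum of termwise bounds is tight
    exactly when every term is. *)
Lemma K_family_leqif (l m : nat) (L : {set {set 'I_m}}) :
  L \subset lsubsets l m ->
  K_family L <= (l - 1) * 'C(#|L|, 2) ?= iff
    [forall i : 'I_#|L|, forall (j : 'I_#|L| | i < j),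
      #|(enum_val i : {set 'I_m}) :&: enum_val j| == l - 1].
Proof.
move=> sL; rewrite -sum_pairs_const.
have cardL (i : 'I_#|L|) : #|enum_val i : {set 'I_m}| = l.
  by have /(subsetP sL) := enum_valP i; rewrite inE => /eqP.
apply: leqif_sum => i _; apply: leqif_sum => j ij.
split=> //; apply: card_setI_distinct => //.
by rewrite (inj_eq enum_val_inj) neq_ltn ij.
Qed.

(** Distinct members have distinct ranks in the enumeration, and symmetry of the intersection lets
    the smaller rank come first. *)
Lemma close_pairsP (l m : nat) (L : {set {set 'I_m}}) :
  reflect (close l L)
    [forall i : 'I_#|L|, forall (j : 'I_#|L| | i < j),
      #|(enum_val i : {set 'I_m}) :&: enum_val j| == l - 1].
Proof.
apply: (iffP forallP) => [H A B AL BL neAB|clL i]; last first.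
  apply/forall_inP => j ij; apply/eqP/clL; rewrite ?enum_valP //.
  by rewrite (inj_eq enum_val_inj) neq_ltn ij.
rewrite -(enum_rankK_in AL AL) -(enum_rankK_in AL BL).
set i := enum_rank_in AL A; set j := enum_rank_in AL B.
have : i != j by apply: contra neAB => /eqP/(enum_rank_in_inj AL BL)/eqP.
rewrite neq_ltn => /orP[] ij; last rewrite setIC.
  by have /forall_inP/(_ j ij)/eqP := H i.
by have /forall_inP/(_ i ij)/eqP := H j.
Qed.

Lemma K_family_close (l m : nat) (L : {set {set 'I_m}}) :
  L \subset lsubsets l m ->
  K_family L = (l - 1) * 'C(#|L|, 2) <-> close l L.
Proof.
move=> sL; have /leqifP := K_family_leqif sL.
by case: close_pairsP => [clL /eqP eK|ncl ltK]; split=> // eK; move: ltK; rewrite eK ltnn.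
Qed.

Lemma closeS (l m : nat) (L L' : {set {set 'I_m}}) :
  L' \subset L -> close l L -> close l L'.
Proof. by move=> /subsetP sL clL A B /sL AL /sL BL; apply: clL. Qed.

Definition lsubsets_below (m l : nat) (U : {set 'I_m}) : {set {set 'I_m}} :=
  [set A : {set 'I_m} | A \subset U & #|A| == l].

Definition lsubsets_above (m l : nat) (I : {set 'I_m}) : {set {set 'I_m}} :=
  [set A : {set 'I_m} | I \subset A & #|A| == l].

Lemma card_lsubsets_below (l m : nat) (U : {set 'I_m}) :
  #|U| = l.+1 -> #|lsubsets_below l U| = l.+1.
Proof. by move=> Ul; rewrite cards_draws Ul binSn. Qed.

(** Complementation maps these sets bijectively onto the [(m - l)]-subsets of [~: I], a set of
    [m - l + 1] points. *)
Lemma card_lsubsets_above (l m : nat) (I : {set 'I_m}) :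
  0 < l <= m -> #|I| = l - 1 -> #|lsubsets_above l I| = (m - l).+1.
Proof.
move=> /andP[l0 lm] Il.
have CIl : #|~: I| = (m - l).+1.
  by rewrite cardsCs setCK card_ord Il subnBA // addn1 subSn.
rewrite -(card_lsubsets_below CIl) -(card_imset _ (@setC_inj _)).
apply: eq_card => A; apply/imsetP/idP => [[B]|].
  rewrite !inE => /andP[IB /eqP Bl] ->.
  by rewrite setCS IB cardsCs setCK card_ord Bl eqxx.
rewrite inE => /andP[AI /eqP Al]; exists (~: A); last by rewrite setCK.
by rewrite inE -setCS setCK AI cardsCs setCK card_ord Al subKn /=.
Qed.

Lemma close_lsubsets_below (l m : nat) (U : {set 'I_m}) :
  #|U| = l.+1 -> close l (lsubsets_below l U).
Proof.
move=> Ul A B; rewrite !inE => /andP[AU /eqP Al] /andP[BU /eqP Bl] neAB.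
apply/eqP; rewrite eqn_leq card_setI_distinct //=.
have : #|A :|: B| <= l.+1 by rewrite -Ul subset_leq_card // subUset AU.
rewrite cardsU Al Bl !leq_subLR => le.
by rewrite -(leq_add2r l) add1n addSnnS.
Qed.

Lemma close_lsubsets_above (l m : nat) (I : {set 'I_m}) :
  #|I| = l - 1 -> close l (lsubsets_above l I).
Proof.
move=> Il A B; rewrite !inE => /andP[IA /eqP Al] /andP[IB /eqP Bl] neAB.
apply/eqP; rewrite eqn_leq card_setI_distinct //= -Il.
by rewrite subset_leq_card // subsetI IA.
Qed.

Section CloseFamily.

Variables (l m : nat) (L : {set {set 'I_m}}).
Hypotheses (hl : 0 < l) (sL : L \subset lsubsets l m) (clL : close l L).

Lemma close_card A : A \in L -> #|A| = l.
Proof. by move=> /(subsetP sL); rewrite inE => /eqP. Qed.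

(** As [D] misses [i], [A :&: D] lies in [A :\ i]; both have [l - 1] elements, so they coincide. *)
Lemma close_subD1 A D i :
  A \in L -> D \in L -> i \in A -> i \notin D -> A :\ i \subset D.
Proof.
move=> AL DL iA iD.
have neAD : A != D by apply: contraNneq iD => <-.
have /eqP <- : A :&: D == A :\ i; last exact: subsetIr.
rewrite eqEcard subsetD1 subsetIl inE (negbTE iD) andbF /= clL //.
by have := cardsD1 i A; rewrite iA (close_card AL) => ->; rewrite add1n subn1.
Qed.

Lemma close_cardU A B : A \in L -> B \in L -> A != B -> #|A :|: B| = l.+1.
Proof.
move=> AL BL neAB; rewrite cardsU clL // !close_card // subnBA //.
by rewrite -addnA addKn addn1.
Qed.

(** Both [A :\ i] and [B :\ i] lie in [D], hence so does their union, which already has [l]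
    elements. *)
Lemma close_miss A B D i :
  A \in L -> B \in L -> A != B -> D \in L ->
  i \in A :&: B -> i \notin D -> D = (A :|: B) :\ i.
Proof.
move=> AL BL neAB DL /setIP[iA iB] iD; apply/esym/eqP.
rewrite eqEcard setDUl subUset !close_subD1 //= -setDUl close_card //.
by have := cardsD1 i (A :|: B); rewrite inE iA close_cardU // add1n => -[<-].
Qed.

Lemma close_dichotomy A B :
  A \in L -> B \in L -> A != B ->
  L \subset lsubsets_above l (A :&: B) \/ L \subset lsubsets_below l (A :|: B).
Proof.
move=> AL BL neAB.
have [/forall_inP allI|] := boolP [forall (D | D \in L), A :&: B \subset D].
  by left; apply/subsetP => D DL; rewrite inE allI // close_card /=.
rewrite negb_forall_in => /exists_inP[D DL /subsetPn[i iAB iD]].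
right; apply/subsetP => C CL; rewrite inE close_card // eqxx andbT.
have DU : D \subset A :|: B by rewrite (close_miss AL BL neAB DL iAB iD) subsetDl.
have [iC|iC] := boolP (i \in C); last first.
  by rewrite (close_miss AL BL neAB CL iAB iC) subsetDl.
(* Here [C] contains [i] while [D] misses it, so [C :\ i] lies in [D], hence in [A :|: B]; the point
   [i] itself lies in [A]. *)
rewrite -(setD1K iC) subUset sub1set (subset_trans _ DU) ?close_subD1 // andbT.
by case/setIP: iAB => iA _; rewrite inE iA.
Qed.

Lemma close_card_le : l <= m -> #|L| <= maxn l (m - l) + 1.
Proof.
move=> lm; have [le1|/card_gt1P[A [B [AL BL neAB]]]] := leqP #|L| 1.
  by rewrite (leq_trans le1) // leq_addl.
rewrite addn1 -maxnSS leq_max.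
case: (close_dichotomy AL BL neAB) => /subset_leq_card.
  by rewrite card_lsubsets_above ?hl ?clL // => ->; rewrite orbT.
by rewrite card_lsubsets_below ?close_cardU // => ->.
Qed.

End CloseFamily.

(** Closeness passes to subfamilies, so a close family with at least [r] members suffices. *)
Lemma exists_close (l m r : nat) :
  0 < l <= m -> r <= 'C(m, l) -> r <= maxn l (m - l) + 1 ->
  exists2 L : {set {set 'I_m}}, L \subset lsubsets l m & #|L| = r /\ close l L.
Proof.
move=> /andP[l0 lm] rk rmu.
have shrink (L : {set {set 'I_m}}) :
    L \subset lsubsets l m -> close l L -> r <= #|L| ->
    exists2 L : {set {set 'I_m}}, L \subset lsubsets l m & #|L| = r /\ close l L.
  move=> sL clL /exists_subset_card[L' sL' cL'].
  by exists L'; [apply: subset_trans sL | split=> //; apply: closeS clL].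
have above : r <= (m - l).+1 -> exists2 L : {set {set 'I_m}},
    L \subset lsubsets l m & #|L| = r /\ close l L.
  have [|I _ Il] := @exists_subset_card _ [set: 'I_m] (l - 1).
    by rewrite cardsT card_ord (leq_trans (leq_subr _ _)).
  rewrite -(card_lsubsets_above _ Il) ?l0 //; apply: shrink.
    by apply/subsetP => A; rewrite !inE => /andP[].
  exact: close_lsubsets_above.
move: rmu; rewrite addn1 -maxnSS leq_max => /orP[rl|]; last exact: above.
(* For [l = m] there is no [(l + 1)]-subset to work below, but then [r <= 'C(m, m) = 1] and the
   family above an [(l - 1)]-set is large enough. *)
have [lt_lm|ge_lm] := ltnP l m; last first.
  have eml : m = l by apply/eqP; rewrite eqn_leq ge_lm lm.
  by apply: above; rewrite (leq_trans rk) // eml binn.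
have [|U _ Ul] := @exists_subset_card _ [set: 'I_m] l.+1.
  by rewrite cardsT card_ord.
move: rl; rewrite -(card_lsubsets_below Ul); apply: shrink.
  by apply/subsetP => A; rewrite !inE => /andP[].
exact: close_lsubsets_below.
Qed.

Theorem proposition4 (l m : nat) (hl : 1 <= l) (hlm : l <= m) :
  let k := 'C(m, l) in
  let mu := maxn l (m - l) + 1 in
  (forall L : {set {set 'I_m}}, L \subset lsubsets l m ->
     K_family L <= (l - 1) * 'C(#|L|, 2) /\
     (K_family L = (l - 1) * 'C(#|L|, 2) <-> close l L)) /\
  (forall r : nat, r <= k ->
     K_max r l m <= (l - 1) * 'C(r, 2) /\
     (K_max r l m = (l - 1) * 'C(r, 2) <-> r <= mu)).
Proof.
move=> k mu; split=> [L sL|r rk].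
  by split; [case: (K_family_leqif sL) | apply: K_family_close].
have Kle : K_max r l m <= (l - 1) * 'C(r, 2).
  apply/bigmax_leqP => L /andP[sL /eqP <-].
  by case: (K_family_leqif sL).
split=> //; split=> [|rmu].
  (* Since [r <= k], some family of [r] sets exists, so the maximum is attained by an actual [L];
     equality then makes this [L] close. *)
  have [|L] := @eq_bigmax_cond _
      [pred L : {set {set 'I_m}} | (L \subset lsubsets l m) && (#|L| == r)]
      (@K_family m).
    have := rk; rewrite /k -[m in 'C(m, _)]card_ord -card_draws.
    case/exists_subset_card => L sL Lr; apply/card_gt0P; exists L.
    by rewrite inE sL Lr /=.
  rewrite inE => /andP[sL /eqP Lr] eK; rewrite /K_max eK -Lr.
  by move=> /(K_family_close sL) clL; apply: close_card_le.
have [|L sL [Lr clL]] := @exists_close l m r _ rk rmu; first by rewrite hl.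
apply/eqP; rewrite eqn_leq Kle /= -{1}Lr.
have /(K_family_close sL) <- := clL.
by rewrite /K_max (bigD1 L) ?leq_maxl // sL Lr /=.
Qed.
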